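(* Let $a$, $b$, $c$ be pairwise coprime positive integers with $a+c$ even. Then for all integers $p,q\geq1$ and all $x,y,z\in\mathbb{R}$, \begin{align*} a^{1-p}b^{1-q}S^{(3,5)}_{p,q}(a,b,c:x,y,z) &=-\frac{q}{2}\sum_{j=1}^{p}\binom{p-1}{j-1}a^{1-j}c^{1+j-p-q}S^{(4)}_{p+q-j,j}(c,-a,b:z,x,y)\\ &\quad+\sum_{h=0}^{q}\binom{q}{h}(-1)^{h}b^{1-h}c^{1+h-p-q}S^{(3,5)}_{p+q-h,h}(c,b,a:z,-y,x). \end{align*}
   Context: $B_n(x)$ is the $n$th Bernoulli polynomial ($\frac{te^{xt}}{e^t-1}=\sum B_n(x)\frac{t^n}{n!}$) and $\mathcal{B}_n(x)=B_n(x-[x])$ the $n$th Bernoulli function ($[x]$ the largest integer $\le x$; $\mathcal{B}_0\equiv1$). $E_n(x)$ is the $n$th Euler polynomial ($\frac{2e^{xt}}{e^t+1}=\sum E_n(x)\frac{t^n}{n!}$), and the Euler function $\mathcal{E}_n$ ($n\ge0$) is defined by $\mathcal{E}_n(x)=E_n(x)$ for $0\le x<1$ and $\mathcal{E}_n(x+m)=(-1)^m\mathcal{E}_n(x)$ for $m\in\mathbb{Z}$. For integers $a,b$, a positive integer $c$ and real $x,y,z$ define, for integers $p\ge1$, $q\ge0$, $$S^{(3,5)}_{p,q}(a,b,c:x,y,z)=\sum_{\mu=0}^{c-1}(-1)^{\mu}\mathcal{E}_{p-1}\Big(a\frac{\mu+z}{c}+x\Big)\mathcal{B}_{q}\Big(b\frac{\mu+z}{c}+y\Big),$$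 and, for integers $p,q\ge1$, $$S^{(4)}_{p,q}(a,b,c:x,y,z)=\sum_{\mu=0}^{c-1}\mathcal{E}_{p-1}\Big(a\frac{\mu+z}{c}+x\Big)\mathcal{E}_{q-1}\Big(b\frac{\mu+z}{c}+y\Big).$$ *)

(* Defs.v *)
From HB Require Import structures.
From mathcomp Require Import all_boot all_order all_algebra.
From mathcomp Require Import reals.
Set Implicit Arguments. Unset Strict Implicit. Unset Printing Implicit Defensive.
Import Order.TTheory GRing.Theory Num.Theory.
Local Open Scope ring_scope.

(* Bernoulli polynomials, from t e^{xt}/(e^t-1) = sum B_n(x) t^n/n!.
   Multiplying by (e^t-1)/t = sum_m t^m/(m+1)! and comparing coefficients of t^n:
   sum_{k=0}^n C(n,k) B_k(x)/(n-k+1) = x^n.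
   bern_seq x n = [:: B_0(x); ...; B_n(x)]. *)
Fixpoint bern_seq (R : realType) (x : R) (n : nat) : seq R :=
  match n with
  | 0 => [:: 1]
  | n'.+1 => let s := bern_seq x n' in
      rcons s (x ^+ n'.+1 -
        \sum_(k < n'.+1) 'C(n'.+1, k)%:R * s`_k / (n'.+1 - k + 1)%:R)
  end.
Definition bernoulli_poly (R : realType) (n : nat) (x : R) : R := (bern_seq x n)`_n.

(* Euler polynomials, from 2e^{xt}/(e^t+1) = sum E_n(x) t^n/n!.
   Multiplying by (e^t+1)/2 = 1 + sum_{m>=1} t^m/(2 m!):
   E_n(x) + (1/2) sum_{k<n} C(n,k) E_k(x) = x^n. *)
Fixpoint euler_seq (R : realType) (x : R) (n : nat) : seq R :=
  match n with
  | 0 => [:: 1]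
  | n'.+1 => let s := euler_seq x n' in
      rcons s (x ^+ n'.+1 - 2^-1 * \sum_(k < n'.+1) 'C(n'.+1, k)%:R * s`_k)
  end.
Definition euler_poly (R : realType) (n : nat) (x : R) : R := (euler_seq x n)`_n.

Definition bernoulli_fun (R : realType) (n : nat) (x : R) : R :=
  bernoulli_poly n (x - (Num.floor x)%:~R).

(* Euler function: E_n(x - [x]) * (-1)^[x], i.e. E_n on [0,1), (-1)^m-antiperiodic *)
Definition euler_fun (R : realType) (n : nat) (x : R) : R :=
  euler_poly n (x - (Num.floor x)%:~R) * (-1) ^ (Num.floor x).

Definition S35 (R : realType) (p q : nat) (a b : int) (c : nat) (x y z : R) : R :=
  \sum_(mu < c) (-1) ^+ mu *
    euler_fun (p - 1) (a%:~R * ((mu%:R + z) / c%:R) + x) *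
    bernoulli_fun q (b%:~R * ((mu%:R + z) / c%:R) + y).

Definition S4 (R : realType) (p q : nat) (a b : int) (c : nat) (x y z : R) : R :=
  \sum_(mu < c)
    euler_fun (p - 1) (a%:~R * ((mu%:R + z) / c%:R) + x) *
    euler_fun (q - 1) (b%:~R * ((mu%:R + z) / c%:R) + y).

(* Main.v *)
Require Import Defs.
From HB Require Import structures.
From mathcomp Require Import all_boot all_order all_algebra.
From mathcomp Require Import reals.
From mathcomp Require Import zify ring lra.

(** Both a and c are odd.  Put u_i = (x+i)/a, v_j = (y+j)/b, w_k = (z+k)/c.  The
    multiplication formulas spread each factor of each sum over all residues, so
    that every S becomes a triple sum over (i, j, k) weighted by (-1)^(k+i), in which
    the powers of a, b, c cancel.  The theorem then holds term by term, being the
    identity, for X = w_k + u_i, Y = w_k + v_j and m = p - 1,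
      E_m(X) B_q(Y) = - q/2 sum_i C(m,i) E_{m+q-1-i}(Y) E_i(X-Y)
                      + sum_h C(q,h) (-1)^h E_{m+q-h}(X) B_h(X-Y)
    between the periodic functions.  By (anti)periodicity X and Y may be taken in
    [0, 1), and X = Y + d with d fixed makes it an identity between polynomials
    in Y; it holds because the difference F of its sides satisfies
    F(Y+1) = - F(Y), which forces F = 0. *)

Set Implicit Arguments. Unset Strict Implicit. Unset Printing Implicit Defensive.
Import Order.TTheory GRing.Theory Num.Theory.
Local Open Scope ring_scope.

(** * Appell sequences *)

(* appell c is the sequence with sum_{k <= n} C(n,k) c(n-k) P_k = X^n, read with
   c(0) = 1 whatever the actual value of c at 0. *)
Section AppellPolynomials.
Variables (R : numFieldType) (c : nat -> R).
Implicit Types (n k : nat) (x y : R).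

Fixpoint appell_seq n : seq {poly R} :=
  if n is m.+1 then
    let s := appell_seq m in
    rcons s ('X^(m.+1) -
      \sum_(k < m.+1) ('C(m.+1, k)%:R * c (m.+1 - k)) *: s`_k)
  else [:: 1].

Definition appell n := (appell_seq n)`_n.

Lemma size_appell_seq n : size (appell_seq n) = n.+1.
Proof. by elim: n => //= n IHn; rewrite size_rcons IHn. Qed.

Lemma nth_appell_seq n k : (k <= n)%N -> (appell_seq n)`_k = appell k.
Proof.
elim: n => [|n IHn]; first by rewrite leqn0 => /eqP->.
rewrite leq_eqVlt => /orP[/eqP-> //|]; rewrite ltnS => le_kn.
by rewrite /= nth_rcons size_appell_seq ltnS le_kn IHn.
Qed.

Lemma appellE n :
  appell n = 'X^n - \sum_(k < n) ('C(n, k)%:R * c (n - k)) *: appell k.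
Proof.
case: n => [|n]; first by rewrite big_ord0 subr0 expr0.
rewrite {1}/appell /= nth_rcons size_appell_seq ltnn eqxx.
by congr (_ - _); apply: eq_bigr => k _; rewrite nth_appell_seq // -ltnS.
Qed.

Lemma appell0 : appell 0 = 1.
Proof. by []. Qed.

Lemma size_appell n : (size (appell n) <= n.+1)%N.
Proof.
elim/ltn_ind: n => n IHn; rewrite appellE.
rewrite (leq_trans (size_polyD _ _)) // geq_max size_polyXn leqnn size_polyN /=.
apply: (leq_trans (size_sum _ _ _)); apply/bigmax_leqP => k _.
apply: (leq_trans (size_scale_leq _ _)).
by apply: (leq_trans (IHn k (ltn_ord k))); rewrite ltnW // ltnS.
Qed.

(** Differentiating the recursion kills the term k = 0; for the others, (k+1) C(n+1,k+1) = (n+1)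
    C(n,k) gives back the recursion one degree lower. *)
Lemma deriv_appell n : (appell n)^`() = n%:R *: appell n.-1.
Proof.
elim/ltn_ind: n => -[|n] IHn; first by rewrite appell0 derivC scale0r.
rewrite (appellE n.+1) derivB derivXn (appellE n) scalerBr -scaler_nat.
congr (_ - _); rewrite raddf_sum big_ord_recl /= derivZ appell0 derivC scaler0 add0r.
rewrite scaler_sumr; apply: eq_bigr => k _.
rewrite /bump /= add1n derivZ IHn ?ltnS //=.
rewrite !scalerA subSS; congr (_ *: _).
have := congr1 (fun i => i%:R : R) (mul_bin_diag n.+1 k).
rewrite /= !natrM => E; rewrite mulrA E; ring.
Qed.

Lemma derivn_appell n k : (appell n)^`(k) = (n ^_ k)%:R *: appell (n - k).
Proof.
elim: k => [|k IHk]; first by rewrite subn0 ffactn0 scale1r.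
rewrite derivnS IHk derivZ deriv_appell scalerA -natrM ffactnSr.
by rewrite subnS.
Qed.

Lemma nderivn_appell n k : (appell n)^`N(k) = 'C(n, k)%:R *: appell (n - k).
Proof.
have kf0 : (k`!)%:R != 0 :> R by rewrite pnatr_eq0 -lt0n fact_gt0.
apply: (scalerI kf0); rewrite [LHS]scaler_nat -nderivn_def derivn_appell.
by rewrite scalerA -natrM mulnC bin_ffact.
Qed.

(** Taylor expansion at [x], summed in reverse order. *)
Lemma appellD n x y :
  (appell n).[x + y] = \sum_(k < n.+1) 'C(n, k)%:R * y ^+ (n - k) * (appell k).[x].
Proof.
rewrite (nderiv_taylor_wide (mulrC _ _) (size_appell n)).
rewrite (reindex_inj rev_ord_inj) /=; apply: eq_bigr => k _.
have le_kn : (k <= n)%N by rewrite -ltnS.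
by rewrite nderivn_appell hornerZ subSS bin_sub // subKn // mulrAC.
Qed.

End AppellPolynomials.

(** * Polynomials with a period or an antiperiod *)

Section PeriodicPolynomials.
Variables (R : numFieldType) (P : {poly R}) (h : R).
Hypothesis h_neq0 : h != 0.

(** P - P(0) vanishes at 0, h, 2h, ..., which are more points than its degree allows. *)
Lemma poly_periodic_const : (forall x, P.[x + h] = P.[x]) -> P = P.[0]%:P.
Proof.
move=> Ph; have Pn n : P.[h *+ n] = P.[0].
  by elim: n => [|n IHn]; rewrite ?mulr0n // mulrSr Ph.
apply/eqP; rewrite -subr_eq0; apply/eqP.
pose s := [seq h *+ i | i <- iota 0 (size (P - P.[0]%:P))].
apply: (@roots_geq_poly_eq0 _ _ s); last by rewrite size_map size_iota.
- by apply/allP => _ /mapP[i _ ->]; rewrite rootE !hornerE Pn subrr.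
- by rewrite map_inj_uniq ?iota_uniq // => i j /(mulrIn h_neq0).
Qed.

End PeriodicPolynomials.

Lemma poly_antiperiodic_eq0 (R : numFieldType) (P : {poly R}) (h : R) :
  h != 0 -> (forall x, P.[x + h] = - P.[x]) -> P = 0.
Proof.
move=> h_neq0 Ph.
have h2_neq0 : h *+ 2 != 0 by rewrite mulrn_eq0.
have defP : P = P.[0]%:P.
  by apply: (poly_periodic_const h2_neq0) => x; rewrite mulr2n addrA !Ph opprK.
have := Ph 0; rewrite defP !hornerC => /eqP.
by rewrite -addr_eq0 -mulr2n mulrn_eq0 /= => /eqP->.
Qed.

(** * Bernoulli and Euler polynomials *)

Section BernoulliEulerPolynomials.
Variable R : numFieldType.
Implicit Types (n m : nat) (x y : R).

(** Divided by m!, these are the coefficients of t^m in (e^t-1)/t and, for m >= 1, in (e^t+1)/2;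
    both series have constant term 1. *)
Definition bern_coef m : R := m.+1%:R^-1.
Definition euler_coef m : R := 2^-1.

Notation B := (appell bern_coef).
Notation E := (appell euler_coef).

Lemma bern_horner_sum n x :
  \sum_(k < n.+1) 'C(n, k)%:R * bern_coef (n - k) * (B k).[x] = x ^+ n.
Proof.
rewrite big_ord_recr /= binn subnn mul1r [bern_coef 0]invr1 mul1r.
rewrite appellE !hornerE horner_sum /= [X in X - _]addrC.
by rewrite [X in _ - X](eq_bigr _ (fun k _ => hornerZ _ _ _)) addrK.
Qed.

(** The addition formula leaves the sum of C(n,k) B_k(x) over k < n, and C(n,k) = n C(n-1,k) / (n-k)
    makes it n times the recursion for x^(n-1). *)
Lemma bern_diff n x : (B n).[x + 1] = (B n).[x] + n%:R * x ^+ n.-1.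
Proof.
rewrite appellD big_ord_recr /= binn subnn expr0 !mul1r addrC; congr (_ + _).
case: n => [|n]; first by rewrite big_ord0 mul0r.
rewrite -bern_horner_sum mulr_sumr; apply: eq_bigr => k _.
rewrite expr1n mulr1 mulrA; congr (_ * _); rewrite /bern_coef mulrA.
have /(congr1 (fun i => i%:R : R)) := mul_bin_down n.+1 k.
rewrite /= !natrM => ->; have le_kn : (k <= n)%N by rewrite -ltnS.
rewrite subSn // mulrC mulKf //.
by rewrite pnatr_eq0.
Qed.

(** By the addition formula the left side is twice the defining recursion. *)
Lemma euler_diff n x : (E n).[x + 1] + (E n).[x] = 2 * x ^+ n.
Proof.
rewrite appellD big_ord_recr /= binn subnn expr0 !mul1r.
rewrite -addrA -[X in _ + X]mulr2n -[X in _ + X]mulr_natl appellE !hornerE.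
rewrite mulrBr addrCA -{2}[2 * x ^+ n]addr0; congr (_ + _).
rewrite horner_sum mulr_sumr -sumrB big1 // => k _.
by rewrite hornerZ /euler_coef expr1n; field.
Qed.

(** The difference Q_k of the two sides has period 1, so it is constant for every k; as Q_(n+1)' =
    -(n+1) Q_n, the constant Q_n is 0. *)
Lemma bern_reflect n x : (B n).[1 - x] = (-1) ^+ n * (B n).[x].
Proof.
pose Q k := (B k) \Po (1%:P - 'X) - (-1) ^+ k *: B k.
have Qx k y : (Q k).[y] = (B k).[1 - y] - (-1) ^+ k * (B k).[y].
  by rewrite /Q !hornerE horner_comp !hornerE.
suff: (Q n).[x] = 0 by rewrite Qx => /eqP; rewrite subr_eq0 => /eqP.
have Qc k : Q k = (Q k).[0]%:P.
  apply: (poly_periodic_const (oner_neq0 R)) => y; rewrite !Qx.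
  have := bern_diff k (- y); rewrite [- y + 1]addrC => ->.
  rewrite bern_diff (_ : 1 - (y + 1) = - y); last by ring.
  case: k => [|k]; first by rewrite !mul0r !addr0.
  by rewrite /= [(- y) ^+ _]exprNn exprS; ring.
have dQ : (Q n.+1)^`() = - n.+1%:R *: Q n.
  rewrite /Q derivB derivZ deriv_comp !deriv_appell derivB derivC derivX sub0r.
  rewrite comp_polyZ mulrN1 exprS scalerBr !scalerA !scaleNr /=.
  by congr (_ - _ *: _); ring.
have /eqP : (Q n.+1)^`() = 0 by rewrite Qc derivC.
by rewrite dQ scaler_eq0 oppr_eq0 pnatr_eq0 /= => /eqP->; rewrite horner0.
Qed.

End BernoulliEulerPolynomials.

(** * Multiplication formulas for the polynomials *)

Section PolynomialMultiplication.
Variable R : numFieldType.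
Implicit Types (n m : nat) (x y : R).

Notation B := (appell (@bern_coef R)).
Notation E := (appell (@euler_coef R)).

(** Same method as for reflection, in the variable y = b x: replacing y by y + 1 moves each node to
    the next one, and the last node to the first plus 1. *)
Lemma bern_mul n b x : (0 < b)%N ->
  \sum_(j < b) b%:R ^+ n * (B n).[x + j%:R / b%:R] = b%:R * (B n).[b%:R * x].
Proof.
move=> b_gt0; have b_neq0 : b%:R != 0 :> R by rewrite pnatr_eq0 -lt0n.
pose Q k : {poly R} :=
  \sum_(j < b) b%:R ^+ k *: (B k \Po (b%:R^-1 *: 'X + (j%:R / b%:R)%:P))
  - b%:R *: B k.
have Qx k y : (Q k).[y] =
  \sum_(j < b) b%:R ^+ k * (B k).[(y + j%:R) / b%:R] - b%:R * (B k).[y].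
  rewrite /Q hornerD horner_sum hornerN hornerZ; congr (_ - _).
  apply: eq_bigr => j _; rewrite hornerZ horner_comp !hornerE.
  by congr (_ * _.[_]); rewrite mulrC mulrDl.
suff: (Q n).[b%:R * x] = 0.
  rewrite Qx => /eqP; rewrite subr_eq0 => /eqP <-; apply: eq_bigr => j _.
  by congr (_ * _.[_]); field.
have Qc k : Q k = (Q k).[0]%:P.
  apply: (poly_periodic_const (oner_neq0 R)) => y; rewrite !Qx.
  case: b b_gt0 b_neq0 {Q Qx} => // b _ b_neq0.
  rewrite big_ord_recr big_ord_recl /= bern_diff.
  rewrite (_ : (y + 1 + b%:R) / b.+1%:R = (y + 0%:R) / b.+1%:R + 1); last first.
    by rewrite -[b.+1]addn1 natrD in b_neq0 *; field.
  rewrite bern_diff addr0.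
  under [X in X + _ - _]eq_bigr do rewrite -addrA nat1r.
  rewrite /bump /=.
  case: k => [|k]; first by ring.
  rewrite /= exprMn exprVn exprS.
  move: (b.+1%:R : R) b_neq0 => t t_neq0; field.
  by rewrite expf_neq0.
have dQ : (Q n.+1)^`() = n.+1%:R *: Q n.
  rewrite /Q derivB derivZ raddf_sum scalerBr scaler_sumr /= deriv_appell.
  rewrite [_ *: (_ *: _)]scalerA [_ *: (_ *: B n)]scalerA mulrC; congr (_ - _).
  apply: eq_bigr => j _; rewrite derivZ deriv_comp deriv_appell /= comp_polyZ.
  rewrite derivD derivZ derivX derivC addr0 -scalerAl -scalerAr mulr1 !scalerA.
  by congr (_ *: _); rewrite exprS; field.
have /eqP : (Q n.+1)^`() = 0 by rewrite Qc derivC.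
by rewrite dQ scaler_eq0 pnatr_eq0 /= => /eqP->; rewrite horner0.
Qed.

(** A shift by 1/a moves each node to the next one, of opposite sign, so in Q(y+1/a) + Q(y) only the
    end nodes survive. As [a] is odd both carry the sign +, and [euler_diff] makes the total
    vanish. *)
Lemma euler_mul n a x : odd a ->
  \sum_(i < a) (-1) ^+ i * (a%:R ^+ n * (E n).[x + i%:R / a%:R]) = (E n).[a%:R * x].
Proof.
move=> a_odd; have a_neq0 : a%:R != 0 :> R.
  by rewrite pnatr_eq0; apply: contraTneq a_odd => ->.
pose Q : {poly R} := \sum_(i < a) ((-1) ^+ i * a%:R ^+ n) *:
   (E n \Po ('X + (i%:R / a%:R)%:P)) - (E n \Po (a%:R *: 'X)).
have Qx y : Q.[y] = \sum_(i < a) (-1) ^+ i * (a%:R ^+ n * (E n).[y + i%:R / a%:R])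
   - (E n).[a%:R * y].
  rewrite /Q hornerD horner_sum hornerN !horner_comp !hornerE; congr (_ - _).
  by apply: eq_bigr => j _; rewrite hornerZ horner_comp !hornerE.
suff Q0 : Q = 0 by have /eqP := Qx x; rewrite Q0 horner0 eq_sym subr_eq0 => /eqP.
have ai_neq0 : a%:R^-1 != 0 :> R by rewrite invr_eq0.
apply: (poly_antiperiodic_eq0 ai_neq0) => y; apply/eqP; rewrite -addr_eq0 !Qx.
rewrite mulrDr mulfV // addrACA -opprD euler_diff.
case: a a_odd a_neq0 {Q Qx ai_neq0} => // a /= a_even a_neq0.
rewrite big_ord_recr big_ord_recl /= -signr_odd (negPf a_even) expr0 !mul1r.
set S := \sum_(i < a) _; set S' := \sum_(i < a) _.
have -> : S = - S'.
  rewrite -sumrN; apply: eq_bigr => i _.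
  rewrite /bump /= exprS natrD mulrDl mul1r addrA.
  by rewrite !mulN1r mulNr opprK.
have -> : y + a.+1%:R^-1 + a%:R / a.+1%:R = y + 1.
  by rewrite -addrA; congr (_ + _); rewrite -{1}[_^-1]mul1r -mulrDl nat1r mulfV.
rewrite mul0r addr0 exprMn mulrCA -euler_diff; apply/eqP; ring.
Qed.

End PolynomialMultiplication.

(** * The product identity between polynomials *)

Section PolynomialIdentity.
Variable R : numFieldType.
Implicit Types (m q : nat) (s d x : R).

Notation B := (appell (@bern_coef R)).
Notation E := (appell (@euler_coef R)).

(* The hypothesis says that F(x+1) = - F(x) for the difference F of the two sides.
   It is met by (s, d') = (-1, d) and (s, d') = (1, d+1): the cases d >= 0 and d < 0
   once d is reduced modulo 1. *)
Lemma euler_bern_mul_aux m q s d (d' : R) : (0 < q)%N ->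
  (forall x, s * q%:R * x ^+ q.-1 * (E m).[x + d'] +
      2 * (x + d) ^+ m * ((-1) ^+ q * (B q).[d' - (x + d)]) =
    2 * (x + d) ^+ m * (B q).[x] +
      q%:R * x ^+ q.-1 * (2 * (x + d) ^+ m - (E m).[x + d])) ->
  forall x, (E m).[x + d] * (B q).[x] =
    s * (q%:R / 2) *
      \sum_(i < m.+1) 'C(m, i)%:R * (E (m + q - i.+1)).[x] * (E i).[d'] +
    \sum_(h < q.+1) 'C(q, h)%:R * (-1) ^+ h *
      (E (m + q - h)).[x + d] * (B h).[d'].
Proof.
move=> q_gt0 shiftE x; pose T := 'X + d%:P.
pose F : {poly R} := (E m \Po T) * B q -
  ((s * (q%:R / 2)) *:
    \sum_(i < m.+1) ('C(m, i)%:R * (E i).[d']) *: E (m + q - i.+1) +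
  \sum_(h < q.+1) ('C(q, h)%:R * (-1) ^+ h * (B h).[d']) *: (E (m + q - h) \Po T)).
have Fx y : F.[y] = (E m).[y + d] * (B q).[y] -
    (s * (q%:R / 2) *
      \sum_(i < m.+1) 'C(m, i)%:R * (E (m + q - i.+1)).[y] * (E i).[d'] +
    \sum_(h < q.+1) 'C(q, h)%:R * (-1) ^+ h *
      (E (m + q - h)).[y + d] * (B h).[d']).
  rewrite /F /T hornerD hornerN hornerM horner_comp !hornerE !horner_sum.
  congr (_ - (_ * _ + _)); apply: eq_bigr => i _.
    by rewrite hornerZ mulrAC.
  by rewrite hornerZ horner_comp !hornerE mulrAC.
suff F0 : F = 0 by have /eqP := Fx x; rewrite F0 horner0 eq_sym subr_eq0 => /eqP.
apply: (poly_antiperiodic_eq0 (oner_neq0 R)) => y; apply/eqP; rewrite -addr_eq0.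
rewrite !Fx addrACA -opprD (addrACA (_ * \sum_(i < _) _)) -mulrDr -!big_split /=.
(* [euler_diff] turns each pair into 2 y^(m+q-1-i), and the addition formula then collapses the
   sum. *)
have -> : \sum_(i < m.+1) ('C(m, i)%:R * (E (m + q - i.+1)).[y + 1] * (E i).[d'] +
    'C(m, i)%:R * (E (m + q - i.+1)).[y] * (E i).[d']) =
    2 * y ^+ q.-1 * (E m).[y + d'].
  rewrite [y + d']addrC appellD mulr_sumr; apply: eq_bigr => i _.
  have le_im : (i <= m)%N by rewrite -ltnS.
  rewrite -mulrDl -mulrDr euler_diff.
  rewrite (_ : (m + q - i.+1 = q.-1 + (m - i))%N); last by lia.
  by rewrite exprD; ring.
(* Likewise, since (-1)^h (y+d)^(q-h) = (-1)^q (-(y+d))^(q-h). *)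
have -> : \sum_(h < q.+1)
   ('C(q, h)%:R * (-1) ^+ h * (E (m + q - h)).[y + 1 + d] * (B h).[d'] +
    'C(q, h)%:R * (-1) ^+ h * (E (m + q - h)).[y + d] * (B h).[d']) =
    2 * (y + d) ^+ m * ((-1) ^+ q * (B q).[d' - (y + d)]).
  rewrite appellD !mulr_sumr; apply: eq_bigr => h _.
  have le_hq : (h <= q)%N by rewrite -ltnS.
  rewrite -mulrDl -mulrDr addrAC euler_diff -addnBA // exprD.
  rewrite [(- (y + d)) ^+ _]exprNn.
  have -> : (-1) ^+ q = (-1) ^+ (q - h) * (-1) ^+ h :> R by rewrite -exprD subnK.
  have := sqrr_sign R (q - h); rewrite expr2.
  by move: ((-1) ^+ (q - h) : R) => e ee; ring: ee.
rewrite [y + 1 + d]addrAC (_ : s * (q%:R / 2) * (2 * y ^+ q.-1 * (E m).[y + d']) =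
  s * q%:R * y ^+ q.-1 * (E m).[y + d']); last by field.
rewrite shiftE bern_diff.
have /eqP := euler_diff m (y + d); rewrite -subr_eq0 => /eqP Em.
(* What remains is B_q(y+1) times the relation [Em]. *)
by apply/eqP; rewrite -[RHS](mulr0 ((B q).[y] + q%:R * y ^+ q.-1)) -Em; ring.
Qed.

(** For d' = d the Bernoulli argument is 1 - (y+1): reflection followed by [bern_diff] gives the
    hypothesis. *)
Lemma euler_bern_mul_ge m q d x : (0 < q)%N ->
  (E m).[x + d] * (B q).[x] =
    - (q%:R / 2) *
      \sum_(i < m.+1) 'C(m, i)%:R * (E (m + q - i.+1)).[x] * (E i).[d] +
    \sum_(h < q.+1) 'C(q, h)%:R * (-1) ^+ h *
      (E (m + q - h)).[x + d] * (B h).[d].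
Proof.
move=> q_gt0; rewrite -[- (_ / _)]mulN1r; apply: euler_bern_mul_aux => // y.
have := bern_reflect q (y + 1).
rewrite (_ : 1 - (y + 1) = d - (y + d)); last by ring.
by move=> ->; rewrite signrMK bern_diff; ring.
Qed.

(** For d' = d + 1 the Bernoulli argument is 1 - y: reflection suffices there, and [euler_diff]
    supplies the Euler terms. *)
Lemma euler_bern_mul_lt m q d x : (0 < q)%N ->
  (E m).[x + d] * (B q).[x] =
    q%:R / 2 *
      \sum_(i < m.+1) 'C(m, i)%:R * (E (m + q - i.+1)).[x] * (E i).[d + 1] +
    \sum_(h < q.+1) 'C(q, h)%:R * (-1) ^+ h *
      (E (m + q - h)).[x + d] * (B h).[d + 1].
Proof.
move=> q_gt0; rewrite -[q%:R / 2]mul1r; apply: euler_bern_mul_aux => // y.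
rewrite (_ : d + 1 - (y + d) = 1 - y); last by ring.
rewrite bern_reflect signrMK [y + (d + 1)]addrA -euler_diff; ring.
Qed.

End PolynomialIdentity.

(** * Bernoulli and Euler functions *)

Section PeriodicFunctions.
Variable R : realType.
Implicit Types (n m : nat) (x y t : R).

Notation B := (appell (@bern_coef R)).
Notation E := (appell (@euler_coef R)).

Lemma bernoulli_polyE n x : bernoulli_poly n x = (B n).[x].
Proof.
(* The recursion reads all earlier entries, so the induction compares whole lists. *)
suff seqE : bern_seq x n = [seq P.[x] | P <- appell_seq (@bern_coef R) n].
  by rewrite /bernoulli_poly seqE (nth_map 0) // size_appell_seq.
elim: n => [|n IHn] /=; first by rewrite hornerC.
rewrite map_rcons -IHn hornerD hornerN hornerXn horner_sum; congr (rcons _ (_ - _)).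
apply: eq_bigr => k _; rewrite hornerZ IHn (nth_map 0) ?size_appell_seq //.
by rewrite /bern_coef addn1 mulrAC.
Qed.

Lemma euler_polyE n x : euler_poly n x = (E n).[x].
Proof.
suff seqE : euler_seq x n = [seq P.[x] | P <- appell_seq (@euler_coef R) n].
  by rewrite /euler_poly seqE (nth_map 0) // size_appell_seq.
elim: n => [|n IHn] /=; first by rewrite hornerC.
rewrite map_rcons -IHn hornerD hornerN hornerXn horner_sum mulr_sumr.
congr (rcons _ (_ - _)); apply: eq_bigr => k _.
by rewrite hornerZ IHn (nth_map 0) ?size_appell_seq // mulrAC mulrC.
Qed.

Lemma bernoulli_funE n x : 0 <= x < 1 -> bernoulli_fun n x = (B n).[x].
Proof.
move=> x01; rewrite /bernoulli_fun (@floor_def _ _ 0) ?add0r // subr0.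
exact: bernoulli_polyE.
Qed.

Lemma euler_funE n x : 0 <= x < 1 -> euler_fun n x = (E n).[x].
Proof.
move=> x01; rewrite /euler_fun (@floor_def _ _ 0) ?add0r // subr0 expr0z mulr1.
exact: euler_polyE.
Qed.

Lemma bernoulli_funD1 n x : bernoulli_fun n (x + 1) = bernoulli_fun n x.
Proof.
rewrite /bernoulli_fun floorDrz ?floor1 // intrD.
by congr (bernoulli_poly _ _); ring.
Qed.

Lemma euler_funD1 n x : euler_fun n (x + 1) = - euler_fun n x.
Proof.
rewrite /euler_fun floorDrz ?floor1 // intrD exprzDr ?unitrN1 // expr1z mulrN1 mulrN.
by congr (- (euler_poly _ _ * _)); ring.
Qed.

Lemma bernoulli_funBn n x k : bernoulli_fun n (x - k%:R) = bernoulli_fun n x.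
Proof.
elim: k => [|k IHk]; first by rewrite subr0.
by rewrite -IHk -(bernoulli_funD1 _ (x - _)) -natr1; congr bernoulli_fun; ring.
Qed.

(** Subtracting floor(t/h) h brings t into [0, h). Invariance as an equivalence also covers
    equations whose two sides both change sign. *)
Lemma periodic_ind (P : R -> Prop) (h : R) : 0 < h ->
    (forall t, P (t + h) <-> P t) -> (forall t, 0 <= t < h -> P t) ->
  forall t, P t.
Proof.
move=> h_gt0 Ph P0 t.
have PD s k : P (s + h *+ k) <-> P s.
  by elim: k => [|k IHk]; rewrite ?addr0 // mulrSr addrA; split=> [/Ph/IHk|/IHk/Ph].
have PDz s (k : int) : P (s + k%:~R * h) <-> P s.
  case: k => k; first by rewrite -pmulrn mulr_natl.
  by rewrite NegzE mulrNz mulNr -pmulrn mulr_natl -(PD (s - _) k.+1) subrK.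
apply/(PDz t (- Num.floor (t / h))); apply: P0; rewrite intrN mulNr subr_ge0.
have /andP[le_f lt_f] := floor_itv (t / h).
rewrite -ler_pdivlMr // le_f /= ltrBlDr -[X in X + _]mul1r -mulrDl.
by rewrite -ltr_pdivrMr // addrC; move: lt_f; rewrite intrD.
Qed.

Lemma mulr_itv01 b t : (0 < b)%N -> 0 <= t < b%:R^-1 -> 0 <= b%:R * t < 1.
Proof.
rewrite -(ltr0n R) => b_pos /andP[t_ge0 t_lt].
by rewrite pmulr_rge0 // t_ge0 mulrC -ltr_pdivlMr // div1r.
Qed.

Lemma addr_divr_itv01 b (j : 'I_b) t :
  0 <= t < b%:R^-1 -> 0 <= t + j%:R / b%:R < 1.
Proof.
have b_gt0 : (0 < b)%N by case: b j => [[]|].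
have b_pos : 0 < b%:R :> R by rewrite ltr0n.
case/andP=> t_ge0 t_lt; apply/andP; split; first by rewrite addr_ge0 ?divr_ge0.
have : t + j%:R / b%:R < b%:R^-1 + j%:R / b%:R by rewrite ltrD2r.
move=> /lt_le_trans; apply.
by rewrite -{1}[_^-1]mul1r -mulrDl nat1r ler_pdivrMr // mul1r ler_nat.
Qed.

(** Both sides have period 1/b in t, and for t in [0, 1/b) all arguments lie in [0, 1), where
    [bern_mul] applies. *)
Lemma bernoulli_fun_mul n b t : (0 < b)%N ->
  \sum_(j < b) b%:R ^+ n * bernoulli_fun n (t + j%:R / b%:R) =
  b%:R * bernoulli_fun n (b%:R * t).
Proof.
move=> b_gt0; have b_pos : 0 < b%:R :> R by rewrite ltr0n.
have b_neq0 := lt0r_neq0 b_pos; move: t.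
apply: (@periodic_ind _ b%:R^-1); first by rewrite invr_gt0.
  move=> t; rewrite mulrDr mulfV // bernoulli_funD1.
  suff -> : \sum_(j < b) b%:R ^+ n * bernoulli_fun n (t + b%:R^-1 + j%:R / b%:R)
     = \sum_(j < b) b%:R ^+ n * bernoulli_fun n (t + j%:R / b%:R) by [].
  case: b b_gt0 b_pos b_neq0 => // b _ _ b_neq0.
  rewrite big_ord_recr big_ord_recl /= addrC; congr (_ + _).
    rewrite mul0r addr0 -(bernoulli_funD1 _ t) -addrA.
    congr (_ * bernoulli_fun _ (_ + _)).
    by rewrite -{1}[_^-1]mul1r -mulrDl nat1r mulfV.
  by apply: eq_bigr => i _; rewrite /bump /= natrD mulrDl mul1r addrA.
move=> t t_itv; rewrite bernoulli_funE ?mulr_itv01 //.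
rewrite -bern_mul //; apply: eq_bigr => j _.
by rewrite bernoulli_funE ?addr_divr_itv01.
Qed.

(** Here both sides change sign under t -> t + 1/a: the last index a - 1 is even, so the node
    wrapping round to t + 1 contributes minus the first term. *)
Lemma euler_fun_mul n a t : odd a ->
  \sum_(i < a) (-1) ^+ i * (a%:R ^+ n * euler_fun n (t + i%:R / a%:R)) =
  euler_fun n (a%:R * t).
Proof.
move=> a_odd; have a_gt0 : (0 < a)%N by case: a a_odd.
have a_pos : 0 < a%:R :> R by rewrite ltr0n.
have a_neq0 := lt0r_neq0 a_pos; move: t.
apply: (@periodic_ind _ a%:R^-1); first by rewrite invr_gt0.
  move=> t; rewrite mulrDr mulfV // euler_funD1.
  suff -> :
    \sum_(i < a) (-1) ^+ i *
       (a%:R ^+ n * euler_fun n (t + a%:R^-1 + i%:R / a%:R)) =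
     - \sum_(i < a) (-1) ^+ i * (a%:R ^+ n * euler_fun n (t + i%:R / a%:R)).
    by split=> [/oppr_inj|->].
  case: a a_odd a_gt0 a_pos a_neq0 => // a /= a_even _ _ a_neq0.
  rewrite big_ord_recr big_ord_recl /= addrC opprD; congr (_ + _).
    rewrite -signr_odd (negPf a_even) expr0 !mul1r mul0r addr0 -mulrN.
    rewrite -euler_funD1 -addrA.
    congr (_ * euler_fun _ (_ + _)).
    by rewrite -{1}[_^-1]mul1r -mulrDl nat1r mulfV.
  rewrite -sumrN; apply: eq_bigr => i _.
  rewrite /bump /= exprS natrD mulrDl mul1r addrA.
  by rewrite !mulN1r mulNr opprK.
move=> t t_itv; rewrite euler_funE ?mulr_itv01 //.
rewrite -euler_mul //; apply: eq_bigr => j _.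
by rewrite euler_funE ?addr_divr_itv01.
Qed.

Lemma bernoulli_fun_distr n b s : (0 < b)%N ->
  (b%:R : R) ^ (1 - n%:Z) * bernoulli_fun n s =
  \sum_(j < b) bernoulli_fun n ((s + j%:R) / b%:R).
Proof.
move=> b_gt0; have b_neq0 : b%:R != 0 :> R by rewrite pnatr_eq0 -lt0n.
rewrite expfzDr // expr1z mulrAC -{1}(mulfVK b_neq0 s) [s / _ * _]mulrC.
rewrite -bernoulli_fun_mul // mulr_suml; apply: eq_bigr => j _.
by rewrite mulrAC -exprnN mulfV ?expf_neq0 // mul1r mulrDl.
Qed.

(** Translate s by the integer b - 1 and reverse the order of the residues. *)
Lemma bernoulli_fun_distrN n b s : (0 < b)%N ->
  (b%:R : R) ^ (1 - n%:Z) * bernoulli_fun n s =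
  \sum_(j < b) bernoulli_fun n ((s - j%:R) / b%:R).
Proof.
move=> b_gt0; rewrite -(bernoulli_funBn n s b.-1) bernoulli_fun_distr //.
rewrite (reindex_inj rev_ord_inj) /=; apply: eq_bigr => j _.
by congr (bernoulli_fun _ (_ / _)); rewrite -subn1 !natrB //; ring.
Qed.

Lemma euler_fun_distr n a s : odd a ->
  (a%:R : R) ^ (- n%:Z) * euler_fun n s =
  \sum_(i < a) (-1) ^+ i * euler_fun n ((s + i%:R) / a%:R).
Proof.
move=> a_odd; have a_neq0 : a%:R != 0 :> R.
  by rewrite pnatr_eq0; apply: contraTneq a_odd => ->.
rewrite -{1}(mulfVK a_neq0 s) [s / _ * _]mulrC -euler_fun_mul //.
rewrite mulr_sumr; apply: eq_bigr => i _.
by rewrite mulrCA [X in _ * X]mulrA -exprnN mulVf ?expf_neq0 // mul1r mulrDl.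
Qed.

Lemma euler_bern_fun_mul m q x y : (0 < q)%N ->
  euler_fun m x * bernoulli_fun q y =
    - (q%:R / 2) *
      \sum_(i < m.+1) 'C(m, i)%:R * euler_fun (m + q - i.+1) y * euler_fun i (x - y) +
    \sum_(h < q.+1) 'C(q, h)%:R * (-1) ^+ h *
      euler_fun (m + q - h) x * bernoulli_fun h (x - y).
Proof.
move=> q_gt0; move: x; apply: (periodic_ind ltr01) => [x|x x01].
  rewrite euler_funD1 mulNr addrAC.
  under eq_bigr do rewrite euler_funD1 mulrN.
  under [X in _ + X]eq_bigr do rewrite euler_funD1 bernoulli_funD1 mulrN mulNr.
  by rewrite !sumrN mulrN -opprD; split=> [/oppr_inj|->].
move: y; apply: (periodic_ind ltr01) => [y|y y01].
  have DE n : euler_fun n (x - (y + 1)) = - euler_fun n (x - y).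
    by rewrite -[in RHS](subrK 1 (x - y)) euler_funD1 opprK opprD addrA.
  have DB n : bernoulli_fun n (x - (y + 1)) = bernoulli_fun n (x - y).
    by rewrite -[in RHS](subrK 1 (x - y)) bernoulli_funD1 opprD addrA.
  (* In y both sides are periodic: the two sign changes in each product of Euler functions
     cancel. *)
  rewrite bernoulli_funD1.
  under eq_bigr do rewrite euler_funD1 DE -mulrA mulrNN mulrA.
  by under [X in _ + X]eq_bigr do rewrite DB.
have [/andP[x_ge0 x_lt1] /andP[y_ge0 y_lt1]] := (x01, y01).
rewrite euler_funE // bernoulli_funE // -{1}(subrK y x) [x - y + y]addrC.
have [le_yx|lt_xy] := leP y x.
  have xy01 : 0 <= x - y < 1 by apply/andP; split; lra.
  rewrite euler_bern_mul_ge // [y + _]addrC subrK.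
  by congr (_ * _ + _); apply: eq_bigr => i _; rewrite !euler_funE ?bernoulli_funE.
have xy01 : 0 <= x - y + 1 < 1 by apply/andP; split; lra.
(* For x < y, antiperiodicity at x - y + 1 accounts for the opposite sign of the first sum. *)
rewrite euler_bern_mul_lt // [y + _]addrC subrK mulNr -mulrN -sumrN.
congr (_ * _ + _); apply: eq_bigr => i _.
  by rewrite -mulrN -euler_funD1 !euler_funE.
by rewrite euler_funE // -[bernoulli_fun _ _]bernoulli_funD1 bernoulli_funE.
Qed.

End PeriodicFunctions.

Lemma sum_mul_sum3 (R : comNzRingType) (I J K M : finType)
    (f : M -> R) (g : M -> I -> J -> K -> R) :
  \sum_m f m * (\sum_i \sum_j \sum_k g m i j k) =
  \sum_i \sum_j \sum_k \sum_m f m * g m i j k.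
Proof.
under eq_bigr do rewrite mulr_sumr; rewrite exchange_big; apply: eq_bigr => i _.
under eq_bigr do rewrite mulr_sumr; rewrite exchange_big; apply: eq_bigr => j _.
by under eq_bigr do rewrite mulr_sumr; rewrite exchange_big.
Qed.

(** * Expansion of the sums over residues modulo a, b and c *)

Section ReciprocityTerms.
Variables (R : realType) (a b c : nat).
Hypotheses (a_odd : odd a) (b_gt0 : (0 < b)%N) (c_odd : odd c).
Variables (x y z : R).

Let u (i : nat) : R := (x + i%:R) / a%:R.
Let v (j : nat) : R := (y + j%:R) / b%:R.
Let w (k : nat) : R := (z + k%:R) / c%:R.

Let a_neq0 : a%:R != 0 :> R.
Proof. by rewrite pnatr_eq0; apply: contraTneq a_odd => ->. Qed.
Let b_neq0 : b%:R != 0 :> R.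
Proof. by rewrite pnatr_eq0 -lt0n. Qed.
Let c_neq0 : c%:R != 0 :> R.
Proof. by rewrite pnatr_eq0; apply: contraTneq c_odd => ->. Qed.

(** Distribution over i and j applies because a w_k + x + i = a (w_k + u_i) and b w_k + y + j = b
    (w_k + v_j). *)
Lemma S35_expand p q :
  (a%:R : R) ^ (- p%:Z) * (b%:R : R) ^ (1 - q%:Z) * S35 p.+1 q a%:Z b%:Z c x y z =
  \sum_(k < c) \sum_(i < a) \sum_(j < b) (-1) ^+ k * (-1) ^+ i *
    (euler_fun p (w k + u i) * bernoulli_fun q (w k + v j)).
Proof.
rewrite /S35 subn1 mulr_sumr; apply: eq_bigr => k _.
rewrite mulrACA [X in X * _ = _]mulrCA -mulrA.
rewrite euler_fun_distr // bernoulli_fun_distr //.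
rewrite big_distrlr mulr_sumr /=; apply: eq_bigr => i _.
rewrite mulr_sumr; apply: eq_bigr => j _.
rewrite -(mulrA ((-1) ^+ i)) -(mulrA ((-1) ^+ k)).
congr (_ * (_ * (euler_fun _ _ * bernoulli_fun _ _))); rewrite /w /u /v; field.
- by rewrite ?a_neq0 ?b_neq0 ?c_neq0.
- by rewrite ?a_neq0 ?b_neq0 ?c_neq0.
Qed.

(** Here j is the summation index; both signs come from distributing the Euler factors, by c v_j + z
    + k = c (w_k + v_j) and -a v_j + x + i = a (u_i - v_j). *)
Lemma S4_expand m n :
  (a%:R : R) ^ (- m%:Z) * (c%:R : R) ^ (- n%:Z) *
    S4 n.+1 m.+1 c%:Z (- a%:Z) b z x y =
  \sum_(k < c) \sum_(i < a) \sum_(j < b) (-1) ^+ k * (-1) ^+ i *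
    (euler_fun n (w k + v j) * euler_fun m (u i - v j)).
Proof.
under eq_bigr do rewrite exchange_big.
rewrite exchange_big /S4 !subn1 mulr_sumr /=; apply: eq_bigr => j _.
rewrite [X in X * _ = _]mulrC mulrACA !euler_fun_distr // big_distrlr /=.
apply: eq_bigr => k _; apply: eq_bigr => i _; rewrite mulrACA.
congr (_ * (euler_fun _ _ * euler_fun _ _)); rewrite /w /u /v ?mulrNz; field.
- by rewrite ?a_neq0 ?b_neq0 ?c_neq0.
- by rewrite ?a_neq0 ?b_neq0 ?c_neq0.
Qed.

(** Here i is the summation index; b u_i - y - j = b (u_i - v_j) calls for distribution over negated
    residues. *)
Lemma S35_dual_expand n h :
  (b%:R : R) ^ (1 - h%:Z) * (c%:R : R) ^ (- n%:Z) *
    S35 n.+1 h c%:Z b%:Z a z (- y) x =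
  \sum_(k < c) \sum_(i < a) \sum_(j < b) (-1) ^+ k * (-1) ^+ i *
    (euler_fun n (w k + u i) * bernoulli_fun h (u i - v j)).
Proof.
rewrite exchange_big /S35 subn1 mulr_sumr; apply: eq_bigr => i _.
rewrite [X in X * _ = _]mulrC mulrACA [X in X * _ = _]mulrCA -mulrA.
rewrite euler_fun_distr // bernoulli_fun_distrN //.
rewrite big_distrlr mulr_sumr /=; apply: eq_bigr => k _.
rewrite mulr_sumr; apply: eq_bigr => j _.
rewrite -!(mulrA ((-1) ^+ k)) mulrCA.
congr (_ * (_ * (euler_fun _ _ * bernoulli_fun _ _))); rewrite /w /u /v; field.
- by rewrite ?a_neq0 ?b_neq0 ?c_neq0.
- by rewrite ?a_neq0 ?b_neq0 ?c_neq0.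
Qed.

End ReciprocityTerms.

(** * The reciprocity law *)

Theorem theorem5 (R : realType) (a b c : nat)
  (ha : (0 < a)%N) (hb : (0 < b)%N) (hc : (0 < c)%N)
  (hab : coprime a b) (hbc : coprime b c) (hac : coprime a c)
  (heven : ~~ odd (a + c))
  (p q : nat) (hp : (1 <= p)%N) (hq : (1 <= q)%N) (x y z : R) :
  (a%:R : R) ^ (1 - p%:Z) * (b%:R : R) ^ (1 - q%:Z) * S35 p q a%:Z b%:Z c x y z =
  - (q%:R / 2) *
    \sum_(1 <= j < p.+1)
      'C(p - 1, j - 1)%:R * (a%:R : R) ^ (1 - j%:Z) *
      (c%:R : R) ^ (1 + j%:Z - p%:Z - q%:Z) *
      S4 (p + q - j) j c%:Z (- a%:Z) b z x y
  + \sum_(0 <= h < q.+1)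
      'C(q, h)%:R * (-1) ^+ h * (b%:R : R) ^ (1 - h%:Z) *
      (c%:R : R) ^ (1 + h%:Z - p%:Z - q%:Z) *
      S35 (p + q - h) h c%:Z b%:Z a z (- y) x.
Proof.
have [a_odd c_odd] : odd a /\ odd c.
  move: heven; rewrite oddD; case a_odd: (odd a); case c_odd: (odd c) => // _.
  have : (2 %| gcdn a c)%N by rewrite dvdn_gcd !dvdn2 a_odd c_odd.
  by rewrite (eqP hac).
case: p hp => // p _; rewrite (_ : 1 - p.+1%:Z = - p%:Z); last by lia.
rewrite (S35_expand a_odd hb c_odd) big_add1 !big_mkord /=.
under [X in _ = _ * X + _]eq_bigr => i _.
  have le_ip : (i <= p)%N by rewrite -ltnS.
  rewrite !subn1 /= (_ : 1 - i.+1%:Z = - i%:Z); last by lia.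
  (* The exponent of [c] is minus the degree of the Euler factor distributed over k; the natural
     subtraction is exact as i <= p and q >= 1. *)
  rewrite (_ : 1 + i.+1%:Z - p.+1%:Z - q%:Z = - (p + q - i.+1)%:Z); last by lia.
  rewrite (_ : (p.+1 + q - i.+1 = (p + q - i.+1).+1)%N); last by lia.
  rewrite -2!mulrA [_ ^ _ * _]mulrA S4_expand //.
  over.
under [X in _ = _ + X]eq_bigr => h _.
  have le_hq : (h <= q)%N by rewrite -ltnS.
  rewrite (_ : 1 + h%:Z - p.+1%:Z - q%:Z = - (p + q - h)%:Z); last by lia.
  rewrite (_ : (p.+1 + q - h = (p + q - h).+1)%N); last by lia.
  rewrite -2!mulrA [_ ^ _ * _]mulrA S35_dual_expand //.
  over.
rewrite !sum_mul_sum3 mulr_sumr -big_split; apply: eq_bigr => k _ /=.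
rewrite mulr_sumr -big_split; apply: eq_bigr => i _ /=.
rewrite mulr_sumr -big_split; apply: eq_bigr => j _ /=.
(* In X - Y the term w_k cancels, leaving u_i - v_j. *)
rewrite (euler_bern_fun_mul _ _ _ hq) opprD addrACA subrr add0r mulrDr.
rewrite mulrCA !mulr_sumr.
by congr (_ + _); apply: eq_bigr => m _; ring.
Qed.
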